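(* Let $I_0,I_1$ denote the modified Bessel functions of the first kind of orders $0$ and $1$, and let $\Phi(x)=e^{-x}\left[I_0(x)+I_1(x)\right]$. Then for all real $r\ge 0$, $$\Phi(2r)=e^{-2r}\left[I_0(2r)+I_1(2r)\right]\ge \frac{\Gamma(2r+1)}{\Gamma^2(r+1)}\,2^{-2r}.$$ *)

(* Defs.v *)
From Stdlib Require Import Reals Factorial.
From Coquelicot Require Import Coquelicot.
Open Scope R_scope.

(** Modified Bessel functions of the first kind, via their power series
    I_nu(x) = sum_{k>=0} (x/2)^(2k+nu) / (k! (k+nu)!)   (nu = 0, 1).
    Both series converge for every real x. *)
Definition bessel_I0 (x : R) : R :=
  Series (fun k : nat => (x / 2) ^ (2 * k) / (INR (fact k) * INR (fact k))).

Definition bessel_I1 (x : R) : R :=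
  Series (fun k : nat => (x / 2) ^ (2 * k + 1) / (INR (fact k) * INR (fact (k + 1)))).

Definition Gamma (s : R) : R :=
  RInt_gen (fun t : R => Rpower t (s - 1) * exp (- t))
           (at_right 0) (Rbar_locally p_infty).

Definition Phi (x : R) : R := exp (- x) * (bessel_I0 x + bessel_I1 x).

(* Main.v *)
(** With [psi p = (p + sin p) / 2], the Bessel integrals give
    [Phi (2 r) = 2/pi * int_0^pi exp (- 2 r (1 - cos p)) psi' p dp]. Since
    [cos (psi p) <= exp (- (1 - cos p))] on [[0, pi)], this is at least
    [2/pi * int_0^pi (cos (psi p))^(2r) psi' p dp = 2/pi * int_0^(pi/2) (cos t)^(2r) dt],
    a Wallis integral which is the Gamma quotient of the theorem. Only the
    inequality for the latter is needed: both sides satisfy the same recurrence in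
    [r -> r + 1] and agree at integers, so it suffices to compare them along
    [r + n] with [n -> infinity], where monotonicity of the integral and
    [Gamma (x + a) <= x^a Gamma x] ([0 <= a <= 1]) suffice. *)
Require Import Defs.
From Stdlib Require Import Reals Factorial Lra Lia.
From Coquelicot Require Import Coquelicot.
Open Scope R_scope.

(** * The cosine bound *)

(** The function [psi] is dictated by the weight in [pi (I_0(x) + I_1(x)) = int_0^pi exp (x cos p)
    (1 + cos p) dp]: since [psi' p = (1 + cos p) / 2], the substitution [t = psi p] absorbs this
    weight exactly and maps [[0, pi]] onto [[0, pi/2]]. The cosine bound becomes algebraic under
    [t = tan (p / 2)], where [psi = atan t + t / (1 + t^2)] and [1 - cos p = 2 t^2 / (1 + t^2)].
    Both logarithms vanish at [t = 0], and comparing their derivatives leaves [tan psi >= 2 t], that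
    is [psi >= atan (2 t)], a mean value estimate for [atan] on [[t, 2 t]]. [Gamma] is evaluated
    only at arguments at least [1], where its integrand is bounded near [0], so a single improper
    end needs a decay estimate. The Wallis integrals are taken with positive exponent, because the
    zeroth power of [cos] extended by [0] jumps at [pi/2]; hence the comparison at integers starts
    at [1], and [r = 0] is settled apart. *)

Lemma MVT_is_derive (f df : R -> R) (a b : R) (hab : a < b)
  (hd : forall x, a <= x <= b -> is_derive f x (df x)) :
  exists c, a < c < b /\ f b - f a = df c * (b - a).
Proof.
  destruct (MVT_cor2 f df a b hab) as [c [h1 h2]].
  - intros c hc; apply is_derive_Reals; auto.
  - exists c; split; [exact h2 | exact h1].
Qed.

Lemma is_derive_atan_inv (x : R) : is_derive atan x (/ (1 + x ^ 2)).
Proof.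
  apply is_derive_Reals, derivable_pt_lim_atan.
Qed.

(** On [[t, 2 t]] the derivative of [atan] is at most its value [1 / (1 + t^2)] at the left end, and
    the interval has length [t]. *)
Lemma atan_double_le (t : R) (ht : 0 <= t) : atan (2 * t) <= atan t + t / (1 + t ^ 2).
Proof.
  destruct (Rle_lt_or_eq_dec 0 t ht) as [hp | <-].
  2:{ rewrite Rmult_0_r, atan_0; lra. }
  destruct (MVT_is_derive atan (fun x => / (1 + x ^ 2)) t (2 * t)) as [c [hc e]].
  - lra.
  - intros; apply is_derive_atan_inv.
  - assert (/ (1 + c ^ 2) <= / (1 + t ^ 2)).
    { apply Rinv_le_contravar; nra. }
    unfold Rdiv; nra.
Qed.

(** The gap [PI / 2 - atan t] is [atan (/ t)]. By the mean value theorem on [[0, / t]] it exceeds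
    [/ t] times the derivative at the right end, which is exactly [t / (1 + t^2)]. This keeps [psi]
    in the range where [cos] is positive and [tan] is increasing. *)
Lemma atan_add_lt_PI2 (t : R) (ht : 0 <= t) : atan t + t / (1 + t ^ 2) < PI / 2.
Proof.
  destruct (Rle_lt_or_eq_dec 0 t ht) as [hp | <-].
  2:{ rewrite atan_0. generalize PI_RGT_0; lra. }
  destruct (MVT_is_derive atan (fun x => / (1 + x ^ 2)) 0 (/ t)) as [c [hc e]].
  - now apply Rinv_0_lt_compat.
  - intros; apply is_derive_atan_inv.
  - rewrite atan_0, atan_inv in e by assumption.
    assert (h : / (1 + (/ t) ^ 2) < / (1 + c ^ 2)).
    { apply Rinv_lt_contravar; [apply Rmult_lt_0_compat|]; nra. }
    apply (Rmult_lt_compat_r (/ t)) in h; [|lra].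
    replace (/ (1 + (/ t) ^ 2) * / t) with (t / (1 + t ^ 2)) in h by (field; nra).
    lra.
Qed.

Lemma ln_cos_atan_le (t : R) (ht : 0 <= t) :
  0 < cos (atan t + t / (1 + t ^ 2)) /\
  ln (cos (atan t + t / (1 + t ^ 2))) <= - (2 * t ^ 2 / (1 + t ^ 2)).
Proof.
  assert (hr : forall u, 0 <= u -> 0 <= atan u + u / (1 + u ^ 2) < PI / 2).
  { intros u hu. split; [|now apply atan_add_lt_PI2].
    generalize (atan_double_le u hu).
    enough (0 <= atan (2 * u)) by lra.
    rewrite <- atan_0. destruct (Req_dec u 0) as [-> | hn].
    - rewrite Rmult_0_r; lra.
    - apply Rlt_le, atan_increasing; lra. }
  assert (hc : forall u, 0 <= u -> 0 < cos (atan u + u / (1 + u ^ 2))).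
  { intros u hu. specialize (hr u hu). apply cos_gt_0; lra. }
  split; [now apply hc|].
  destruct (Rle_lt_or_eq_dec 0 t ht) as [hp | <-].
  2:{ rewrite atan_0. replace (0 + 0 / (1 + 0 ^ 2)) with 0 by field. rewrite cos_0, ln_1. lra. }
  (* The left side has derivative [2 / (1 + u^2)^2 * (2 u - tan psi)], where [psi >= atan (2 u)]. *)
  destruct (MVT_is_derive (fun u => ln (cos (atan u + u / (1 + u ^ 2))) + 2 * u ^ 2 / (1 + u ^ 2))
     (fun u => 2 / (1 + u ^ 2) ^ 2 * (2 * u - tan (atan u + u / (1 + u ^ 2)))) 0 t hp) as [c [h e]].
  - intros u [hu _]. generalize (hc u hu); intros hcu.
    auto_derive; [repeat split; auto; nra|].
    unfold tan. change (u / (1 + u ^ 2)) with (u * / (1 + u * (u * 1))).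
    change (u / (1 + u ^ 2)) with (u * / (1 + u * (u * 1))) in hcu.
    field. split; nra.
  - rewrite atan_0 in e. replace (0 + 0 / (1 + 0 ^ 2)) with 0 in e by field.
    rewrite cos_0, ln_1 in e.
    assert (ht2 : 2 * c <= tan (atan c + c / (1 + c ^ 2))).
    { rewrite <- (tan_atan (2 * c)).
      generalize (atan_double_le c ltac:(lra)) (hr c ltac:(lra)) (atan_bound (2 * c)).
      intros [hlt | ->] h1 h2; [|lra].
      apply Rlt_le, tan_increasing; lra. }
    assert (0 < 2 / (1 + c ^ 2) ^ 2).
    { apply Rdiv_lt_0_compat; [lra|]. apply pow_lt; nra. }
    replace (2 * 0 ^ 2 / (1 + 0 ^ 2)) with 0 in e by field.
    match type of e with _ = ?k * (2 * c - ?T) * _ => assert (k * (T - 2 * c) * t >= 0) end.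
    { apply Rle_ge, Rmult_le_pos; [apply Rmult_le_pos|]; lra. }
    nra.
Qed.

Lemma cos_half_add_sin_le (p : R) (hp : 0 <= p < PI) :
  0 < cos ((p + sin p) / 2) <= exp (- (1 - cos p)).
Proof.
  set (t := tan (p / 2)).
  assert (hc : 0 < cos (p / 2)) by (apply cos_gt_0; lra).
  assert (hs : 0 <= sin (p / 2)) by (apply sin_ge_0; lra).
  assert (ht : 0 <= t).
  { unfold t, tan, Rdiv. apply Rmult_le_pos; [easy|]. now apply Rlt_le, Rinv_0_lt_compat. }
  assert (ea : atan t = p / 2) by (apply atan_tan; lra).
  generalize (sin2_cos2 (p / 2)). unfold Rsqr. intros h1.
  assert (et : 1 + t ^ 2 = / cos (p / 2) ^ 2).
  { unfold t, tan. apply Rmult_eq_reg_r with (cos (p / 2) ^ 2); [|nra]. field_simplify; nra. }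
  assert (es : sin p = 2 * (t / (1 + t ^ 2))).
  { rewrite et. replace p with (2 * (p / 2)) at 1 by field. rewrite sin_2a. unfold t, tan. field; lra. }
  assert (ec : 1 - cos p = 2 * t ^ 2 / (1 + t ^ 2)).
  { rewrite et. replace p with (2 * (p / 2)) at 1 by field. rewrite cos_2a_sin. unfold t, tan. field; lra. }
  destruct (ln_cos_atan_le t ht) as [h2 h3].
  replace ((p + sin p) / 2) with (atan t + t / (1 + t ^ 2)) by (rewrite ea, es; field; nra).
  split; [easy|]. rewrite ec, <- (exp_ln _ h2).
  destruct h3 as [h3 | ->]; [|lra]. now apply Rlt_le, exp_increasing.
Qed.

(** * The Gamma function on [[1, +oo)] *)

Lemma Rpower_pos (x y : R) : 0 < Rpower x y.
Proof. apply exp_pos. Qed.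

Lemma ln_le_sub1 (x : R) (hx : 0 < x) : ln x <= x - 1.
Proof.
  generalize (exp_ineq1_le (ln x)). rewrite exp_ln by easy. lra.
Qed.

(** Half of the exponential absorbs the power: [ln] lies below its tangent at [2 p + 2], whose slope
    [1 / (2 p + 2)] makes [p * ln t] at most [t / 2] plus a constant. The shift by [2] keeps the
    point of tangency positive when [p = 0]. *)
Lemma Rpower_exp_le_decay (p : R) (hp : 0 <= p) :
  exists C, 0 < C /\ forall t, 0 < t -> Rpower t p * exp (- t) <= C * exp (- (t / 2)).
Proof.
  exists (exp (p * ln (2 * p + 2))). split; [apply exp_pos|].
  intros t ht. unfold Rpower. rewrite <- !exp_plus.
  assert (h : ln t <= t / (2 * p + 2) - 1 + ln (2 * p + 2)).
  { replace t with (t / (2 * p + 2) * (2 * p + 2)) at 1 by (field; lra).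
    rewrite ln_mult; [|apply Rdiv_lt_0_compat; lra|lra].
    generalize (ln_le_sub1 (t / (2 * p + 2)) ltac:(apply Rdiv_lt_0_compat; lra)). lra. }
  assert (h2 : p * (t / (2 * p + 2)) <= t / 2).
  { replace (p * (t / (2 * p + 2))) with (t / 2 - t / (2 * p + 2)) by (field; lra).
    assert (0 < t / (2 * p + 2)) by (apply Rdiv_lt_0_compat; lra). lra. }
  apply (Rmult_le_compat_l p) in h; [|lra].
  match goal with |- exp ?a <= exp ?b => assert (hab : a <= b) by nra end.
  destruct hab as [hab | ->]; [|lra]. now apply Rlt_le, exp_increasing.
Qed.

Lemma Rpower_exp_decay (p : R) (hp : 0 <= p) :
  filterlim (fun t => Rpower t p * exp (- t)) (Rbar_locally p_infty) (locally 0).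
Proof.
  destruct (Rpower_exp_le_decay p hp) as [C [hC h]].
  apply (is_lim_le_le_loc (fun _ => 0) (fun t => C * exp (- (t / 2))) _ p_infty 0).
  - exists 0. intros t ht. split; [|now apply h].
    apply Rmult_le_pos; apply Rlt_le; [apply Rpower_pos|apply exp_pos].
  - apply is_lim_const.
  - replace (Finite 0) with (Rbar_mult C 0) by (simpl; f_equal; ring).
    apply is_lim_scal_l.
    apply (is_lim_comp exp (fun t => - (t / 2)) p_infty 0 m_infty).
    + apply is_lim_exp_m.
    + intros P [M hM]. exists (- 2 * M). intros t ht. apply hM. lra.
    + exists 0. now intros.
Qed.

Lemma continuous_Gamma_integrand (s t : R) (ht : 0 < t) :
  continuous (fun t : R => Rpower t (s - 1) * exp (- t)) t.
Proof.
  apply (ex_derive_continuous (V := R_NormedModule)). unfold Rpower. auto_derive; easy.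
Qed.

Lemma ex_RInt_Gamma_integrand (s a b : R) (ha : 0 < a) (hb : 0 < b) :
  ex_RInt (fun t : R => Rpower t (s - 1) * exp (- t)) a b.
Proof.
  apply (ex_RInt_continuous (V := R_CompleteNormedModule)).
  intros z hz. apply continuous_Gamma_integrand.
  generalize (Rmin_glb_lt a b 0 ha hb). lra.
Qed.

(** For [1 <= s] both factors of the integrand are at most [1] on [(0, 1]]. This is the Cauchy
    estimate at the lower end, for endpoints in either order. *)
Lemma abs_RInt_Gamma_integrand_zero (s a b : R) (hs : 1 <= s) (ha : 0 < a <= 1) (hb : 0 < b <= 1) :
  Rabs (RInt (fun t : R => Rpower t (s - 1) * exp (- t)) a b) <= Rabs (b - a).
Proof.
  assert (H : forall a b, 0 < a <= 1 -> 0 < b <= 1 -> a <= b ->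
    Rabs (RInt (fun t : R => Rpower t (s - 1) * exp (- t)) a b) <= Rabs (b - a)).
  { clear a b ha hb. intros a b ha hb hab.
    rewrite (Rabs_pos_eq (b - a)), <- (Rmult_1_r (b - a)) by lra.
    apply abs_RInt_le_const; [easy|apply ex_RInt_Gamma_integrand; lra|].
    intros t ht. rewrite Rabs_pos_eq by (apply Rmult_le_pos; apply Rlt_le, exp_pos).
    apply Rle_trans with (1 * 1); [|lra]. apply Rmult_le_compat; try apply Rlt_le, exp_pos.
    - apply Rle_trans with (Rpower 1 (s - 1)); [apply Rle_Rpower_l; lra|].
      unfold Rpower. rewrite ln_1, Rmult_0_r, exp_0. lra.
    - rewrite <- exp_0. apply Rlt_le, exp_increasing; lra. }
  destruct (Rle_dec a b) as [h|h]; [now apply H|].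
  rewrite <- (opp_RInt_swap (V := R_CompleteNormedModule)) by (apply ex_RInt_Gamma_integrand; lra).
  unfold opp; simpl. rewrite Rabs_Ropp, Rabs_minus_sym. apply H; lra.
Qed.

Lemma abs_RInt_Gamma_integrand_infty (s : R) (hs : 1 <= s) :
  exists C, 0 < C /\ forall M a b, 0 < M -> M <= a -> M <= b ->
  Rabs (RInt (fun t : R => Rpower t (s - 1) * exp (- t)) a b) <= C * exp (- (M / 2)).
Proof.
  destruct (Rpower_exp_le_decay (s - 1) ltac:(lra)) as [C [hC h]].
  exists (2 * C). split; [lra|].
  intros M a b hM ha hb.
  assert (H : forall a b, M <= a -> M <= b -> a <= b ->
    Rabs (RInt (fun t : R => Rpower t (s - 1) * exp (- t)) a b) <= 2 * C * exp (- (M / 2))).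
  { clear a b ha hb. intros a b ha hb hab.
    assert (hI : is_RInt (fun t => C * exp (- (t / 2))) a b
       (minus (- 2 * C * exp (- (b / 2))) (- 2 * C * exp (- (a / 2))))).
    { apply (is_RInt_derive (V := R_CompleteNormedModule) (fun t => - 2 * C * exp (- (t / 2)))).
      - intros t _. auto_derive; [easy|]. unfold Rdiv. field.
      - intros t _. apply (ex_derive_continuous (V := R_NormedModule)). auto_derive; easy. }
    rewrite Rabs_pos_eq.
    - apply Rle_trans with (RInt (fun t => C * exp (- (t / 2))) a b).
      + apply RInt_le; [easy|apply ex_RInt_Gamma_integrand; lra|eexists; exact hI|].
        intros t ht. apply h; lra.
      + rewrite (is_RInt_unique _ _ _ _ hI). unfold minus, plus, opp; simpl.
        assert (exp (- (a / 2)) <= exp (- (M / 2))).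
        { destruct ha as [ha | ->]; [|lra]. apply Rlt_le, exp_increasing; lra. }
        generalize (exp_pos (- (b / 2))). nra.
    - apply RInt_ge_0; [easy|apply ex_RInt_Gamma_integrand; lra|].
      intros; apply Rmult_le_pos; apply Rlt_le, exp_pos. }
  destruct (Rle_dec a b) as [hab|hab]; [now apply H|].
  rewrite <- (opp_RInt_swap (V := R_CompleteNormedModule)) by (apply ex_RInt_Gamma_integrand; lra).
  unfold opp; simpl. rewrite Rabs_Ropp. apply H; lra.
Qed.

Lemma at_right_0_lt (d : R) (hd : 0 < d) : at_right 0 (fun x => 0 < x < d).
Proof.
  exists (mkposreal d hd). intros y hy hy0. split; [easy|].
  unfold ball in hy; simpl in hy; unfold AbsRing_ball, abs, minus, plus, opp in hy; simpl in hy.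
  rewrite Rabs_pos_eq in hy; lra.
Qed.

(** [RInt_gen] is a total function, so [Gamma s] carries information only once convergence is known;
    it follows from the Cauchy criterion for the product of the two endpoint filters. *)
Lemma is_RInt_gen_Gamma (s : R) (hs : 1 <= s) :
  is_RInt_gen (fun t : R => Rpower t (s - 1) * exp (- t)) (at_right 0) (Rbar_locally p_infty)
    (Gamma s).
Proof.
  apply (RInt_gen_correct (V := R_CompleteNormedModule)).
  set (f := fun t : R => Rpower t (s - 1) * exp (- t)).
  assert (ex : forall a b, 0 < a -> 0 < b -> ex_RInt f a b)
    by now intros; apply ex_RInt_Gamma_integrand.
  apply (filterlimi_locally_cauchy (F := filter_prod (at_right 0) (Rbar_locally p_infty))
    (fun ab => is_RInt f (fst ab) (snd ab))).
  - exists (fun x => 0 < x < 1) (fun y => 1 < y); [now apply at_right_0_lt, Rlt_0_1|now exists 1|].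
    intros a b ha hb. split.
    + apply ex; simpl; lra.
    + intros y1 y2 h1 h2. apply (is_RInt_unique (V := R_CompleteNormedModule)) in h1. apply (is_RInt_unique (V := R_CompleteNormedModule)) in h2. congruence.
  - intros [eps he].
    destruct (abs_RInt_Gamma_integrand_infty s hs) as [C [hC H]].
    assert (hlim : Rbar_locally p_infty (fun M => C * exp (- (M / 2)) < eps / 2)).
    (* This is the solution [M] of [C * exp (- (M / 2)) = eps / 2]. *)
    { exists (2 * ln (2 * C / eps)). intros M hM.
      assert (exp (- (M / 2)) < exp (- ln (2 * C / eps))) by (apply exp_increasing; lra).
      assert (0 < 2 * C / eps) by (apply Rdiv_lt_0_compat; lra).
      rewrite (exp_Ropp (ln _)), exp_ln in H0 by easy.
      apply (Rmult_lt_compat_l C) in H0; [|easy].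
      replace (C * / (2 * C / eps)) with (eps / 2) in H0 by (field; lra). easy. }
    destruct hlim as [M0 hM0].
    set (M := Rmax M0 0 + 1).
    generalize (Rmax_l M0 0) (Rmax_r M0 0); intros m1 m2.
    specialize (hM0 M ltac:(unfold M; lra)).
    set (d := Rmin 1 (eps / 2)).
    assert (d <= 1) by apply Rmin_l.
    assert (d <= eps / 2) by apply Rmin_r.
    assert (hd : 0 < d) by (apply Rmin_glb_lt; lra).
    exists (fun ab => 0 < fst ab < d /\ M < snd ab). split.
    { exists (fun x => 0 < x < d) (fun y => M < y); [now apply at_right_0_lt|now exists M|easy]. }
    intros [a b] [a' b']; simpl. intros [ha hb] [ha' hb'] I I' hI hI'.
    apply (is_RInt_unique (V := R_CompleteNormedModule)) in hI. apply (is_RInt_unique (V := R_CompleteNormedModule)) in hI'. subst I I'.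
    assert (0 < M) by (unfold M; lra).
    (* The two integrals differ by a piece near [0], of size below [d <= eps / 2], and a piece
       beyond [M], of size below [eps / 2]. *)
    assert (e : RInt f a b = RInt f a a' + RInt f a' b' + RInt f b' b).
    { rewrite <- (RInt_Chasles (V := R_CompleteNormedModule) f a b' b) by (apply ex; lra).
      rewrite <- (RInt_Chasles (V := R_CompleteNormedModule) f a a' b') by (apply ex; lra).
      easy. }
    assert (h1 : Rabs (RInt f a a') <= Rabs (a' - a))
      by (apply abs_RInt_Gamma_integrand_zero; lra).
    assert (h2 : Rabs (RInt f b' b) <= C * exp (- (M / 2))) by (apply H; lra).
    assert (h3 : Rabs (a' - a) < d) by (apply Rabs_def1; lra).
    unfold ball; simpl; unfold AbsRing_ball, abs, minus, plus, opp; simpl.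
    rewrite e. apply Rabs_def1;
    generalize (Rle_abs (RInt f a a')) (Rle_abs (RInt f b' b))
      (Rle_abs (- RInt f a a')) (Rle_abs (- RInt f b' b)); rewrite !Rabs_Ropp; lra.
Qed.

(** Lets the side conditions of improper integrals be checked for ordered positive endpoints only,
    so that [Rmin] and [Rmax] disappear. *)
Lemma at_right_0_p_infty_between :
  filter_prod (at_right 0) (Rbar_locally p_infty) (fun ab => 0 < fst ab /\ fst ab <= snd ab).
Proof.
  exists (fun x => 0 < x < 1) (fun y => 1 < y); [now apply at_right_0_lt, Rlt_0_1|now exists 1|].
  simpl; intros; lra.
Qed.

Lemma is_RInt_gen_pos_le (f g : R -> R) (lf lg : R)
  (hf : is_RInt_gen f (at_right 0) (Rbar_locally p_infty) lf)
  (hg : is_RInt_gen g (at_right 0) (Rbar_locally p_infty) lg)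
  (hfg : forall x, 0 < x -> f x <= g x) : lf <= lg.
Proof.
  assert (h := is_RInt_gen_minus _ _ _ _ hg hf).
  (* Monotonicity is drawn from the norm inequality: the zero integrand, written [0 * (g - f)], is
     dominated in norm by [g - f], so the integral [lg - lf] is at least [0]. *)
  assert (h0 := is_RInt_gen_scal _ 0 _ h).
  assert (hle : norm (scal 0 (minus lg lf)) <= minus lg lf).
  { refine (RInt_gen_norm _ _ _ _ _ _ h0 h).
    - generalize at_right_0_p_infty_between. apply filter_imp. now intros.
    - generalize at_right_0_p_infty_between. apply filter_imp. intros [a b] hab x hx. simpl in *.
      specialize (hfg x ltac:(lra)).
      unfold norm, scal, minus, plus, opp; simpl. unfold abs, mult; simpl.
      rewrite Rmult_0_l, Rabs_R0. lra. }
  unfold norm, scal, minus, plus, opp in hle; simpl in hle. unfold abs, mult in hle; simpl in hle.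
  rewrite Rmult_0_l, Rabs_R0 in hle. lra.
Qed.

(** Integration by parts: the derivative of [F t = t^s exp (- t)] is the difference of the two
    integrands, and [F] vanishes at both ends. *)
Lemma Gamma_plus_1 (s : R) (hs : 1 <= s) : Gamma (s + 1) = s * Gamma s.
Proof.
  set (F := fun t => Rpower t s * exp (- t)).
  assert (hd : forall t, 0 < t -> is_derive F t
     (s * (Rpower t (s - 1) * exp (- t)) - Rpower t (s + 1 - 1) * exp (- t))).
  { intros t ht. unfold F. replace (s + 1 - 1) with s by ring.
    replace (s * (Rpower t (s - 1) * exp (- t)) - Rpower t s * exp (- t))
      with (s * Rpower t (s - 1) * exp (- t) + Rpower t s * (- exp (- t))) by ring.
    apply (is_derive_mult (fun t => Rpower t s) (fun t => exp (- t))).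
    - apply is_derive_Reals, derivable_pt_lim_power, ht.
    - auto_derive; [easy|ring].
    - intros; apply Rmult_comm. }
  assert (h1 := is_RInt_gen_Gamma s hs).
  assert (h2 := is_RInt_gen_Gamma (s + 1) ltac:(lra)).
  assert (h3 := is_RInt_gen_minus _ _ _ _ (is_RInt_gen_scal _ s _ h1) h2).
  assert (h4 : is_RInt_gen (Derive F) (at_right 0) (Rbar_locally p_infty) (0 - 0)).
  { apply is_RInt_gen_Derive.
    - generalize at_right_0_p_infty_between. apply filter_imp. intros [a b] hab x hx. simpl in *.
      eexists; apply hd. rewrite Rmin_left in hx; lra.
    - generalize at_right_0_p_infty_between. apply filter_imp. intros [a b] hab x hx. simpl in *.
      rewrite Rmin_left in hx by lra.
      assert (hx0 : 0 < x) by lra.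
      apply (continuous_ext_loc _ (fun t => s * (Rpower t (s - 1) * exp (- t)) - Rpower t (s + 1 - 1) * exp (- t))).
      + exists (mkposreal x hx0). intros y hy. symmetry. apply is_derive_unique, hd.
        unfold ball in hy; simpl in hy; unfold AbsRing_ball, abs, minus, plus, opp in hy; simpl in hy.
        apply Rabs_def2 in hy; lra.
      + apply (continuous_minus (V := R_NormedModule)).
        * apply (continuous_scal_r (V := R_NormedModule)), continuous_Gamma_integrand, hx0.
        * now apply continuous_Gamma_integrand.
    - apply filterlim_locally. intros [eps he].
      set (d := Rmin 1 eps).
      assert (d <= 1) by apply Rmin_l.
      assert (d <= eps) by apply Rmin_r.
      assert (hd0 : 0 < d) by (apply Rmin_glb_lt; lra).
      generalize (at_right_0_lt d hd0). apply filter_imp. intros x hx.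
      unfold ball; simpl; unfold AbsRing_ball, abs, minus, plus, opp; simpl.
      unfold F. rewrite Ropp_0, Rplus_0_r, Rabs_pos_eq by (apply Rmult_le_pos; apply Rlt_le, exp_pos).
      (* Near [0], [F x <= x] because [x^s = x^(s - 1) * x] with [s - 1 >= 0] and [x < 1]. *)
      apply Rle_lt_trans with (x * 1); [|lra].
      apply Rmult_le_compat; try apply Rlt_le, exp_pos.
      + replace s with ((s - 1) + 1) by ring. rewrite Rpower_plus, Rpower_1 by lra.
        apply Rle_trans with (1 * x); [|lra]. apply Rmult_le_compat_r; [lra|].
        apply Rle_trans with (Rpower 1 (s - 1)); [apply Rle_Rpower_l; lra|].
        unfold Rpower. rewrite ln_1, !Rmult_0_r, exp_0. lra.
      + rewrite <- exp_0. apply Rlt_le, exp_increasing; lra.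
    - apply Rpower_exp_decay; lra. }
  apply (is_RInt_gen_unique (V := R_CompleteNormedModule)) in h4.
  match type of h3 with is_RInt_gen ?f _ _ ?l =>
    assert (h6 : is_RInt_gen (Derive F) (at_right 0) (Rbar_locally p_infty) l) end.
  { revert h3. apply is_RInt_gen_ext.
    generalize at_right_0_p_infty_between. apply filter_imp. intros [a b] hab x hx. simpl in *.
    rewrite Rmin_left in hx by lra. symmetry. apply is_derive_unique, hd. lra. }
  apply (is_RInt_gen_unique (V := R_CompleteNormedModule)) in h6. rewrite h4 in h6.
  unfold minus, scal, plus, opp, mult in h6; simpl in h6. unfold mult in h6; simpl in h6. lra.
Qed.

Lemma Gamma_1 : Gamma 1 = 1.
Proof.
  assert (e : forall t, Derive (fun t => - exp (- t)) t = exp (- t)).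
  { intros t. apply is_derive_unique. auto_derive; [easy|ring]. }
  assert (h : is_RInt_gen (Derive (fun t => - exp (- t))) (at_right 0) (Rbar_locally p_infty)
     (0 - (- 1))).
  { apply is_RInt_gen_Derive.
    - apply filter_forall. intros ab x _. auto_derive; easy.
    - apply filter_forall. intros ab x _.
      apply (continuous_ext (fun t => exp (- t))); [intros; now rewrite e|].
      apply (ex_derive_continuous (V := R_NormedModule)). auto_derive; easy.
    - assert (hc : continuous (fun t => - exp (- t)) 0)
        by (apply (ex_derive_continuous (V := R_NormedModule)); auto_derive; easy).
      unfold continuous in hc. rewrite Ropp_0, exp_0 in hc.
      intros P hP. destruct (hc P hP) as [d hd]. exists d. intros y hy _. now apply hd.
    - replace 0 with (- 0) by ring.
      apply (is_lim_opp (fun t => exp (- t)) p_infty 0).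
      apply (is_lim_comp exp (fun t => - t) p_infty 0 m_infty).
      + apply is_lim_exp_m.
      + apply (is_lim_opp (fun t => t) p_infty p_infty), is_lim_id.
      + exists 0. now intros. }
  assert (h2 := is_RInt_gen_Gamma 1 (Rle_refl 1)).
  assert (h3 : is_RInt_gen (Derive (fun t => - exp (- t))) (at_right 0) (Rbar_locally p_infty)
     (Gamma 1)).
  { revert h2. apply is_RInt_gen_ext.
    generalize at_right_0_p_infty_between. apply filter_imp. intros [a b] hab x hx. simpl in *.
    rewrite Rmin_left in hx by lra.
    rewrite e. replace (1 - 1) with 0 by ring. rewrite Rpower_O by lra. ring. }
  apply (is_RInt_gen_unique (V := R_CompleteNormedModule)) in h.
  apply (is_RInt_gen_unique (V := R_CompleteNormedModule)) in h3.
  lra.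
Qed.

Lemma Gamma_fact (n : nat) : Gamma (INR n + 1) = INR (fact n).
Proof.
  induction n as [|n IH].
  - simpl. rewrite Rplus_0_l. apply Gamma_1.
  - rewrite Gamma_plus_1, S_INR, IH, fact_simpl, mult_INR, S_INR; [easy|].
    rewrite S_INR; generalize (pos_INR n); lra.
Qed.

(** Concavity of [t^a], or weighted AM-GM for [t / x] and [1] with weights [a] and [1 - a] and mean
    [m]. The bound [ln u <= u - 1], taken at [t / x / m] and at [/ m] and averaged with these
    weights, has right side [0]. *)
Lemma Rpower_le_tangent (t x a : R) (ht : 0 < t) (hx : 0 < x) (ha : 0 <= a <= 1) :
  Rpower t a <= Rpower x a * (1 - a + a * (t / x)).
Proof.
  set (m := 1 - a + a * (t / x)).
  assert (hu : 0 < t / x) by now apply Rdiv_lt_0_compat.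
  assert (hm : 0 < m) by (unfold m; destruct (Req_dec a 0) as [->|]; nra).
  assert (h1 := ln_le_sub1 (t / x / m) ltac:(now apply Rdiv_lt_0_compat)).
  assert (h2 := ln_le_sub1 (/ m) ltac:(now apply Rinv_0_lt_compat)).
  rewrite (ln_div (t / x)), ln_div in h1 by easy. rewrite ln_Rinv in h2 by easy.
  assert (e : a * (t / x / m) + (1 - a) * / m = 1).
  { transitivity (m * / m); [|apply Rinv_r; lra]. unfold Rdiv. generalize (/ m). unfold m. intros w.
    unfold Rdiv. ring. }
  assert (h : a * ln t <= a * ln x + ln m) by nra.
  rewrite <- (exp_ln m hm). unfold Rpower. rewrite <- exp_plus.
  destruct h as [h | ->]; [now apply Rlt_le, exp_increasing|lra].
Qed.

(* Log-convexity of [Gamma] in the form of Wendel's inequality, from integrating the tangent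
   bound on [t ^ a] at [t = x]. *)
Lemma Gamma_plus_le (x a : R) (hx : 1 <= x) (ha : 0 <= a <= 1) :
  Gamma (x + a) <= Rpower x a * Gamma x.
Proof.
  assert (h1 := is_RInt_gen_Gamma (x + a) ltac:(lra)).
  assert (h2 := is_RInt_gen_scal _ ((1 - a) * Rpower x a) _ (is_RInt_gen_Gamma x hx)).
  assert (h0 := is_RInt_gen_Gamma (x + 1) ltac:(lra)).
  assert (h3 := is_RInt_gen_scal _ (a / x * Rpower x a) _ h0).
  assert (h4 := is_RInt_gen_plus _ _ _ _ h2 h3).
  assert (h := is_RInt_gen_pos_le _ _ _ _ h1 h4).
  unfold scal, plus, mult in h; simpl in h. unfold mult in h; simpl in h.
  rewrite Gamma_plus_1 in h by easy.
  replace (Rpower x a * Gamma x)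
    with ((1 - a) * Rpower x a * Gamma x + a / x * Rpower x a * (x * Gamma x)) by (field; lra).
  apply h. intros t ht.
  replace (x + a - 1) with ((x - 1) + a) by ring. replace (x + 1 - 1) with ((x - 1) + 1) by ring.
  rewrite !Rpower_plus, Rpower_1 by easy.
  replace ((1 - a) * Rpower x a * (Rpower t (x - 1) * exp (- t))
     + a / x * Rpower x a * (Rpower t (x - 1) * t * exp (- t)))
    with (Rpower t (x - 1) * exp (- t) * (Rpower x a * (1 - a + a * (t / x)))) by (field; lra).
  replace (Rpower t (x - 1) * Rpower t a * exp (- t))
    with (Rpower t (x - 1) * exp (- t) * Rpower t a) by ring.
  apply Rmult_le_compat_l.
  - apply Rmult_le_pos; apply Rlt_le, exp_pos.
  - apply Rpower_le_tangent; lra.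
Qed.

(** With [n] the integer part of [x], Wendel's inequality across the remaining distance to [n + 1]
    bounds the factorial [n!] by a positive multiple of [Gamma x]. *)
Lemma Gamma_pos (x : R) (hx : 1 <= x) : 0 < Gamma x.
Proof.
  assert (h0 : 0 <= x) by lra.
  destruct (nfloor_ex x h0) as [n hn].
  assert (h := Gamma_plus_le x (INR n + 1 - x) hx ltac:(lra)).
  replace (x + (INR n + 1 - x)) with (INR n + 1) in h by ring.
  rewrite Gamma_fact in h.
  assert (h1 := INR_fact_lt_0 n). assert (h2 := Rpower_pos x (INR n + 1 - x)).
  nra.
Qed.

(** * The Gamma quotient: recurrence and growth between integers *)

Definition gamma_quotient (r : R) : R :=
  Gamma (2 * r + 1) / (Gamma (r + 1) ^ 2) * Rpower 2 (- (2 * r)).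

Lemma gamma_quotient_pos (r : R) (hr : 0 <= r) : 0 < gamma_quotient r.
Proof.
  apply Rmult_lt_0_compat; [|apply Rpower_pos].
  apply Rdiv_lt_0_compat; [|apply pow_lt]; apply Gamma_pos; lra.
Qed.

Lemma gamma_quotient_0 : gamma_quotient 0 = 1.
Proof.
  unfold gamma_quotient. rewrite Rmult_0_r, Rplus_0_l, Gamma_1, Ropp_0, Rpower_O by lra. field.
Qed.

Lemma gamma_quotient_succ (r : R) (hr : 0 <= r) :
  gamma_quotient (r + 1) = (2 * r + 1) / (2 * r + 2) * gamma_quotient r.
Proof.
  unfold gamma_quotient.
  replace (2 * (r + 1) + 1) with (2 * r + 1 + 1 + 1) by ring.
  rewrite (Gamma_plus_1 (2 * r + 1 + 1)), (Gamma_plus_1 (2 * r + 1)), (Gamma_plus_1 (r + 1)) by lra.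
  replace (- (2 * (r + 1))) with (- (2 * r) + - (2)) by ring.
  rewrite Rpower_plus, (Rpower_Ropp 2 2).
  replace (Rpower 2 2) with 4.
  2:{ replace 2 with (1 + 1) at 2 by ring. rewrite Rpower_plus, Rpower_1 by lra. ring. }
  assert (h := Gamma_pos (r + 1) ltac:(lra)).
  field. lra.
Qed.

(** Wendel's inequality bounds the numerator above, going up from [2 n + 1], and the denominator
    below, going up from [r + n + 1] to [n + 2]. Only the fact that the resulting factor tends to
    [1] matters later. *)
Lemma gamma_quotient_plus_le (n : nat) (r : R) (hr : 0 <= r <= 1) :
  gamma_quotient (r + INR n) <= ((INR n + 2) / (INR n + 1)) ^ 2 * gamma_quotient (INR n).
Proof.
  set (x := INR n). assert (hx : 0 <= x) by apply pos_INR.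
  assert (g0 := Gamma_pos (x + 1) ltac:(lra)).
  assert (g1 := Gamma_pos (2 * x + 1) ltac:(lra)).
  assert (g2 := Gamma_pos (r + x + 1) ltac:(lra)).
  assert (h1 : Gamma (2 * (r + x) + 1) <= Rpower 2 (2 * r) * Rpower (x + 2) (2 * r) * Gamma (2 * x + 1)).
  { assert (a1 := Gamma_plus_le (2 * x + 1 + r) r ltac:(lra) hr).
    assert (a2 := Gamma_plus_le (2 * x + 1) r ltac:(lra) hr).
    replace (2 * (r + x) + 1) with (2 * x + 1 + r + r) by ring.
    replace (2 * r) with (r + r) by ring. rewrite !Rpower_plus.
    assert (b1 : Rpower (2 * x + 1 + r) r <= Rpower (2 * (x + 2)) r) by (apply Rle_Rpower_l; lra).
    assert (b2 : Rpower (2 * x + 1) r <= Rpower (2 * (x + 2)) r) by (apply Rle_Rpower_l; lra).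
    assert (e : Rpower (2 * (x + 2)) r = Rpower 2 r * Rpower (x + 2) r)
      by (rewrite Rpower_mult_distr by lra; easy).
    replace (Rpower 2 r * Rpower 2 r * (Rpower (x + 2) r * Rpower (x + 2) r))
      with (Rpower (2 * (x + 2)) r * Rpower (2 * (x + 2)) r) by (rewrite e; ring).
    apply Rle_trans with (1 := a1). rewrite Rmult_assoc.
    assert (c := Rpower_pos (2 * x + 1 + r) r).
    assert (c' := Rpower_pos (2 * x + 1) r).
    apply Rmult_le_compat; [lra| |easy|].
    - apply Rlt_le, Gamma_pos; lra.
    - apply Rle_trans with (1 := a2). apply Rmult_le_compat_r; lra. }
  assert (h2 : (x + 1) * Gamma (x + 1) <= Rpower (x + 2) (1 - r) * Gamma (r + x + 1)).
  { rewrite <- Gamma_plus_1 by lra.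
    assert (a := Gamma_plus_le (r + x + 1) (1 - r) ltac:(lra) ltac:(lra)).
    replace (r + x + 1 + (1 - r)) with (x + 1 + 1) in a by ring.
    apply Rle_trans with (1 := a). apply Rmult_le_compat_r; [lra|]. apply Rle_Rpower_l; lra. }
  unfold gamma_quotient.
  replace (- (2 * (r + x))) with (- (2 * r) + - (2 * x)) by ring.
  rewrite Rpower_plus, (Rpower_Ropp 2 (2 * r)).
  set (P := Rpower 2 (- (2 * x))). assert (hP : 0 < P) by apply Rpower_pos.
  set (A := Rpower 2 (2 * r)) in *. assert (hA : 0 < A) by apply Rpower_pos.
  replace (2 * r) with (r + r) in h1 by ring. rewrite Rpower_plus in h1.
  assert (e : Rpower (x + 2) r * Rpower (x + 2) (1 - r) = x + 2).
  { rewrite <- Rpower_plus. replace (r + (1 - r)) with 1 by ring. apply Rpower_1; lra. }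
  set (B := Rpower (x + 2) r) in *. set (D := Rpower (x + 2) (1 - r)) in *.
  assert (hB : 0 < B) by apply Rpower_pos. assert (hD : 0 < D) by apply Rpower_pos.
  set (G0 := Gamma (x + 1)) in *. set (G1 := Gamma (2 * x + 1)) in *.
  set (G2 := Gamma (r + x + 1)) in *. set (G := Gamma (2 * (r + x) + 1)) in *.
  assert (h3 : ((x + 1) * G0) ^ 2 <= (D * G2) ^ 2) by (apply pow_incr; nra).
  rewrite <- e.
  (* Both sides are rewritten with a common positive factor, so that what remains is the product of
     [h1] and the squared [h2]. *)
  replace (((B * D) / (x + 1)) ^ 2 * (G1 / G0 ^ 2 * P))
    with ((A * (B * B) * G1) * ((D * G2) ^ 2 * (P / (A * ((x + 1) * G0) ^ 2 * G2 ^ 2))))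
    by (field; lra).
  replace (G / G2 ^ 2 * (/ A * P))
    with (G * (((x + 1) * G0) ^ 2 * (P / (A * ((x + 1) * G0) ^ 2 * G2 ^ 2)))) by (field; lra).
  assert (0 < P / (A * ((x + 1) * G0) ^ 2 * G2 ^ 2)).
  { apply Rdiv_lt_0_compat; [easy|]. repeat apply Rmult_lt_0_compat; try apply pow_lt; try nra. }
  assert (0 < G) by (apply Gamma_pos; lra).
  apply Rmult_le_compat; [lra| |easy|].
  - apply Rmult_le_pos; [apply pow2_ge_0|lra].
  - apply Rmult_le_compat_r; [lra|easy].
Qed.

(** * Wallis integrals with real exponent *)

(* Unlike [Rpower], continuous at [0] when [0 < p]: [Rpower 0 p = 1] since [ln 0 = 0]. *)
Definition pos_power (y p : R) : R := if Rlt_dec 0 y then Rpower y p else 0.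

Lemma pos_power_pos (y p : R) (hy : 0 < y) : pos_power y p = Rpower y p.
Proof. unfold pos_power. now destruct (Rlt_dec 0 y). Qed.

Lemma pos_power_nonpos (y p : R) (hy : y <= 0) : pos_power y p = 0.
Proof. unfold pos_power. destruct (Rlt_dec 0 y); lra. Qed.

Lemma pos_power_plus_1 (y p : R) : pos_power y (p + 1) = y * pos_power y p.
Proof.
  destruct (Rlt_dec 0 y) as [h|h].
  - rewrite !pos_power_pos, Rpower_plus, Rpower_1 by easy. ring.
  - rewrite !pos_power_nonpos by lra. ring.
Qed.

Lemma locally_gt (a y : R) (h : a < y) : locally y (fun z => a < z).
Proof. now apply (open_gt a y). Qed.

Lemma locally_lt (a y : R) (h : y < a) : locally y (fun z => z < a).
Proof. now apply (open_lt a y). Qed.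

Lemma continuous_pos_power (y p : R) (hp : 0 < p) : continuous (fun y => pos_power y p) y.
Proof.
  destruct (Rtotal_order y 0) as [h|[-> | h]].
  - apply (continuous_ext_loc _ (fun _ => 0)); [|apply continuous_const].
    generalize (locally_lt 0 y h). apply filter_imp. intros z hz. rewrite pos_power_nonpos; lra.
  - apply filterlim_locally. intros [e he].
    (* The radius solves [z^p = e]; this is where [0 < p] is needed. *)
    exists (mkposreal (Rpower e (/ p)) (Rpower_pos _ _)). intros z hz.
    change (Rabs (z - 0) < Rpower e (/ p)) in hz.
    change (Rabs (pos_power z p - pos_power 0 p) < e).
    rewrite Rminus_0_r in hz. rewrite (pos_power_nonpos 0), Rminus_0_r by lra.
    destruct (Rlt_dec 0 z) as [hz0|hz0].
    + rewrite Rabs_pos_eq in hz by lra.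
      rewrite pos_power_pos, Rabs_pos_eq by (easy || apply Rlt_le, Rpower_pos).
      replace e with (Rpower (Rpower e (/ p)) p).
      * now apply Rlt_Rpower_l.
      * rewrite Rpower_mult, Rinv_l, Rpower_1 by lra. easy.
    + rewrite pos_power_nonpos, Rabs_R0 by lra. easy.
  - apply (continuous_ext_loc _ (fun y => Rpower y p)).
    + generalize (locally_gt 0 y h). apply filter_imp. intros z hz. now rewrite pos_power_pos.
    + apply (ex_derive_continuous (V := R_NormedModule)). unfold Rpower. auto_derive; easy.
Qed.

Lemma is_derive_pos_power (y p : R) (hp : 0 < p) :
  is_derive (fun y => pos_power y (p + 1)) y ((p + 1) * pos_power y p).
Proof.
  destruct (Rtotal_order y 0) as [h|[-> | h]].
  - apply (is_derive_ext_loc (fun _ => 0)).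
    + generalize (locally_lt 0 y h). apply filter_imp. intros z hz. rewrite pos_power_nonpos; lra.
    + rewrite pos_power_nonpos, Rmult_0_r by lra. apply (is_derive_const (K := R_AbsRing) (V := R_NormedModule) 0).
  (* At [0] the difference quotient of the power [p + 1] is the power [p] itself, so
     differentiability reduces to continuity of the latter. *)
  - apply is_derive_Reals. intros e he.
    generalize (proj1 (filterlim_locally _ _) (continuous_pos_power 0 p hp) (mkposreal e he)).
    intros [d hd]. exists d. intros x hx0 hx.
    specialize (hd x). change (Rabs (x - 0) < d -> Rabs (pos_power x p - pos_power 0 p) < e) in hd.
    rewrite (pos_power_nonpos 0), !Rminus_0_r in hd by lra.
    rewrite (pos_power_nonpos 0 (p + 1)), (pos_power_nonpos 0 p), Rmult_0_r, Rplus_0_l, !Rminus_0_r, pos_power_plus_1 by lra.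
    replace (x * pos_power x p / x) with (pos_power x p) by (field; easy). now apply hd.
  - apply (is_derive_ext_loc (fun y => Rpower y (p + 1))).
    + generalize (locally_gt 0 y h). apply filter_imp. intros z hz. now rewrite pos_power_pos.
    + rewrite pos_power_pos by easy.
      replace (Rpower y p) with (Rpower y (p + 1 - 1)) by (f_equal; ring).
      now apply is_derive_Reals, derivable_pt_lim_power.
Qed.

Definition wallis (a : R) : R := RInt (fun t => pos_power (cos t) (2 * a)) 0 (PI / 2).

Lemma continuous_pos_power_cos (t p : R) (hp : 0 < p) : continuous (fun t => pos_power (cos t) p) t.
Proof.
  apply (continuous_comp cos (fun y => pos_power y p)); [apply continuous_cos|].
  now apply continuous_pos_power.
Qed.

Lemma ex_RInt_pos_power_cos (a b p : R) (hp : 0 < p) :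
  ex_RInt (fun t => pos_power (cos t) p) a b.
Proof.
  apply (ex_RInt_continuous (V := R_CompleteNormedModule)).
  intros; now apply continuous_pos_power_cos.
Qed.

(** Integrate the derivative of [sin t * (cos t)^(2 a + 1)]: the boundary terms vanish, at [PI / 2]
    through [cos] and at [0] through [sin]. *)
Lemma wallis_succ (a : R) (ha : 0 < a) :
  wallis (a + 1) = (2 * a + 1) / (2 * a + 2) * wallis a.
Proof.
  assert (h : is_RInt (fun t => (2 * a + 2) * pos_power (cos t) (2 * (a + 1))
        - (2 * a + 1) * pos_power (cos t) (2 * a)) 0 (PI / 2)
      (minus (sin (PI / 2) * pos_power (cos (PI / 2)) (2 * a + 1))
             (sin 0 * pos_power (cos 0) (2 * a + 1)))).
  { apply (is_RInt_derive (V := R_CompleteNormedModule)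
      (fun t => sin t * pos_power (cos t) (2 * a + 1))).
    - intros t _.
      replace ((2 * a + 2) * pos_power (cos t) (2 * (a + 1))
        - (2 * a + 1) * pos_power (cos t) (2 * a))
        with (cos t * pos_power (cos t) (2 * a + 1)
           + sin t * (- sin t * ((2 * a + 1) * pos_power (cos t) (2 * a)))).
      + apply (is_derive_mult sin (fun t => pos_power (cos t) (2 * a + 1))).
        * apply is_derive_Reals, derivable_pt_lim_sin.
        * apply (is_derive_comp (fun y => pos_power y (2 * a + 1)) cos).
          -- apply is_derive_pos_power; lra.
          -- apply is_derive_Reals, derivable_pt_lim_cos.
        * intros; apply Rmult_comm.
      + replace (2 * (a + 1)) with (2 * a + 1 + 1) by ring. rewrite !pos_power_plus_1.
        generalize (sin2_cos2 t). unfold Rsqr. intros e.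
        replace (sin t * (- sin t * ((2 * a + 1) * pos_power (cos t) (2 * a))))
          with (- (sin t * sin t) * ((2 * a + 1) * pos_power (cos t) (2 * a))) by ring.
        replace (sin t * sin t) with (1 - cos t * cos t) by lra. ring.
    - intros t _. apply (continuous_minus (V := R_NormedModule));
      apply (continuous_scal_r (V := R_NormedModule)), continuous_pos_power_cos; lra. }
  assert (h1 := RInt_correct (V := R_CompleteNormedModule) _ _ _
    (ex_RInt_pos_power_cos 0 (PI / 2) (2 * (a + 1)) ltac:(lra))).
  assert (h2 := RInt_correct (V := R_CompleteNormedModule) _ _ _
    (ex_RInt_pos_power_cos 0 (PI / 2) (2 * a) ltac:(lra))).
  fold (wallis a) in h2. fold (wallis (a + 1)) in h1.
  apply (is_RInt_scal (V := R_NormedModule) _ _ _ (2 * a + 2)) in h1.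
  apply (is_RInt_scal (V := R_NormedModule) _ _ _ (2 * a + 1)) in h2.
  assert (h3 := is_RInt_minus (V := R_NormedModule) _ _ _ _ _ _ h1 h2).
  apply (is_RInt_unique (V := R_CompleteNormedModule)) in h.
  apply (is_RInt_unique (V := R_CompleteNormedModule)) in h3.
  unfold scal, minus, plus, opp, mult in h, h3; simpl in h, h3. unfold mult in h3; simpl in h3.
  rewrite cos_PI2, pos_power_nonpos, sin_0, !Rmult_0_r, Rmult_0_l in h by lra.
  assert (e : (2 * a + 2) * wallis (a + 1) - (2 * a + 1) * wallis a = 0).
  { unfold Rminus. rewrite <- h3. unfold Rminus in h. rewrite h. ring. }
  apply Rmult_eq_reg_l with (2 * a + 2); [|lra]. field_simplify; lra.
Qed.

Lemma wallis_1 : wallis 1 = PI / 2 * gamma_quotient 1.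
Proof.
  replace (gamma_quotient 1) with (/ 2).
  2:{ replace 1 with (0 + 1) at 1 by ring. rewrite gamma_quotient_succ, gamma_quotient_0; lra. }
  assert (hp := PI_RGT_0).
  apply (is_RInt_unique (V := R_CompleteNormedModule)).
  apply (is_RInt_ext (fun t => cos t * cos t)).
  - intros t ht. rewrite Rmin_left, Rmax_right in ht by lra.
    assert (hc : 0 < cos t) by (apply cos_gt_0; lra).
    rewrite pos_power_pos by easy. replace (2 * 1) with (1 + 1) by ring.
    rewrite Rpower_plus, Rpower_1; easy.
  - replace (PI / 2 * / 2) with (minus ((PI / 2 + sin (PI / 2) * cos (PI / 2)) / 2) ((0 + sin 0 * cos 0) / 2)).
    + apply (is_RInt_derive (V := R_CompleteNormedModule) (fun t => (t + sin t * cos t) / 2)).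
      * intros t _. auto_derive; [easy|]. generalize (sin2_cos2 t). unfold Rsqr. intros.
        replace (cos t * cos t) with (/ 2 * (sin t * sin t + cos t * cos t + cos t * cos t - sin t * sin t)) by field.
        rewrite H. field.
      * intros t _. apply (ex_derive_continuous (V := R_NormedModule)). auto_derive; easy.
    + unfold minus, plus, opp; simpl. rewrite sin_0, cos_PI2. field.
Qed.

Lemma wallis_INR (n : nat) : wallis (INR n + 1) = PI / 2 * gamma_quotient (INR n + 1).
Proof.
  induction n as [|n IH].
  - simpl. rewrite Rplus_0_l. apply wallis_1.
  - rewrite S_INR. assert (hn := pos_INR n).
    rewrite wallis_succ, gamma_quotient_succ, IH by lra. ring.
Qed.

Lemma wallis_decreasing (a b : R) (ha : 0 < a) (hab : a <= b) : wallis b <= wallis a.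
Proof.
  assert (hp := PI_RGT_0).
  apply RInt_le; [lra|apply ex_RInt_pos_power_cos; lra|apply ex_RInt_pos_power_cos; lra|].
  intros t ht. assert (hc : 0 < cos t) by (apply cos_gt_0; lra).
  rewrite !pos_power_pos by easy. unfold Rpower.
  assert (hl : ln (cos t) <= 0) by (generalize (ln_le_sub1 _ hc) (COS_bound t); lra).
  assert (h : 2 * b * ln (cos t) <= 2 * a * ln (cos t)) by nra.
  destruct h as [h | ->]; [now apply Rlt_le, exp_increasing|lra].
Qed.

Lemma wallis_ge_0 (a : R) (ha : 0 < a) : 0 <= wallis a.
Proof.
  assert (hp := PI_RGT_0).
  apply RInt_ge_0; [lra|apply ex_RInt_pos_power_cos; lra|].
  intros t _. unfold pos_power. destruct (Rlt_dec 0 (cos t)); [apply Rlt_le, Rpower_pos|lra].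
Qed.

(** * Comparison of the Gamma quotient with the Wallis integral *)

(** The ratio of the two functions has period [1]. The cross-multiplied form avoids dividing by
    [wallis r], for which only nonnegativity is established. *)
Lemma gamma_quotient_wallis_proportional (r : R) (n : nat) (hr : 0 < r) :
  gamma_quotient (r + INR n) * wallis r = gamma_quotient r * wallis (r + INR n).
Proof.
  induction n as [|n IH].
  - simpl. rewrite Rplus_0_r. easy.
  - rewrite S_INR, <- Rplus_assoc. assert (hn := pos_INR n).
    rewrite gamma_quotient_succ, wallis_succ by lra.
    rewrite Rmult_assoc, IH. ring.
Qed.

Lemma gamma_quotient_le_wallis_unit (r : R) (hr : 0 < r <= 1) :
  PI / 2 * gamma_quotient r <= wallis r.
Proof.
  set (X := PI / 2 * gamma_quotient r). set (Y := wallis r).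
  assert (hX : 0 < X).
  { apply Rmult_lt_0_compat; [generalize PI_RGT_0; lra|apply gamma_quotient_pos; lra]. }
  assert (hY : 0 <= Y) by (apply wallis_ge_0; lra).
  (* As [r + n <= n + 1], monotonicity bounds [wallis (r + n)] below by its value at the integer
     [n + 1]. One step of the recurrence from [n] to [n + 1] costs the factor on the left; the
     factor on the right is that of [gamma_quotient_plus_le]. *)
  assert (H : forall n, X * (1 - / (INR n + 1) / 2) <= (1 + / (INR n + 1)) ^ 2 * Y).
  { intros n. assert (hn := pos_INR n).
    assert (h := gamma_quotient_wallis_proportional r n ltac:(lra)).
    assert (h1 := gamma_quotient_plus_le n r ltac:(lra)).
    assert (h2 := wallis_decreasing (r + INR n) (INR n + 1) ltac:(lra) ltac:(lra)).
    rewrite wallis_INR, gamma_quotient_succ in h2 by lra.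
    assert (hg := gamma_quotient_pos (INR n) hn).
    assert (hg2 := gamma_quotient_pos r ltac:(lra)).
    replace (1 - / (INR n + 1) / 2) with ((2 * INR n + 1) / (2 * INR n + 2)) by (field; lra).
    replace (1 + / (INR n + 1)) with ((INR n + 2) / (INR n + 1)) by (field; lra).
    apply Rmult_le_reg_r with (gamma_quotient (INR n)); [easy|].
    apply (Rmult_le_compat_l (gamma_quotient r)) in h2; [|lra].
    apply (Rmult_le_compat_r Y) in h1; [|easy].
    fold Y in h. unfold X. lra. }
  apply Rnot_lt_le. intros hlt.
  (* With [e = / (INR n + 1) <= 1], [(1 + e)^2 <= 1 + 3 e] turns [H] into
     [X - Y <= e * (X / 2 + 3 * Y)], which this choice of [n] contradicts. *)
  destruct (archimed_cor1 ((X - Y) / (X / 2 + 3 * Y + 1))) as [n [hn hn0]].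
  { apply Rdiv_lt_0_compat; lra. }
  apply lt_0_INR in hn0.
  specialize (H n). set (e := / (INR n + 1)) in *.
  assert (he : 0 < e <= 1).
  { split; [apply Rinv_0_lt_compat; lra|]. rewrite <- Rinv_1. apply Rinv_le_contravar; lra. }
  assert (he2 : e < (X - Y) / (X / 2 + 3 * Y + 1)).
  { apply Rle_lt_trans with (2 := hn). apply Rinv_le_contravar; lra. }
  apply (Rmult_lt_compat_r (X / 2 + 3 * Y + 1)) in he2; [|lra].
  replace ((X - Y) / (X / 2 + 3 * Y + 1) * (X / 2 + 3 * Y + 1)) with (X - Y) in he2 by (field; lra).
  assert ((1 + e) ^ 2 <= 1 + 3 * e) by nra.
  nra.
Qed.

Lemma gamma_quotient_le_wallis (r : R) (hr : 0 < r) : PI / 2 * gamma_quotient r <= wallis r.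
Proof.
  assert (H : forall n r, 0 < r <= INR n + 1 -> PI / 2 * gamma_quotient r <= wallis r).
  { clear r hr. induction n as [|n IH]; intros r hr.
    - simpl in hr. apply gamma_quotient_le_wallis_unit; lra.
    - rewrite S_INR in hr. destruct (Rle_dec r 1) as [h|h].
      + apply gamma_quotient_le_wallis_unit; lra.
      + specialize (IH (r - 1) ltac:(lra)).
        replace r with (r - 1 + 1) by ring.
        rewrite gamma_quotient_succ, wallis_succ by lra.
        assert (0 < (2 * (r - 1) + 1) / (2 * (r - 1) + 2)) by (apply Rdiv_lt_0_compat; lra).
        nra. }
  destruct (nfloor_ex r ltac:(lra)) as [n hn]. apply (H n). lra.
Qed.

(** * Integral representation of the Bessel functions *)

Definition exp_sum (n : nat) (y : R) : R := sum_n (fun k => / INR (fact k) * y ^ k) n.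

Lemma is_lim_seq_exp_sum (y : R) : is_lim_seq (fun n => exp_sum n y) (exp y).
Proof. exact (proj1 (is_pseries_R _ _ _) (is_exp_Reals y)). Qed.

Lemma exp_sum_S (n : nat) (y : R) :
  exp_sum (S n) y = exp_sum n y + / INR (fact (S n)) * y ^ S n.
Proof. unfold exp_sum. now rewrite sum_Sn. Qed.

(** The tail of the exponential series at [y] is dominated term by term by the tail at [M]. Taken at
    [y = x * cos p] and [M = Rabs x], this gives convergence uniform in [p]. *)
Lemma abs_exp_sub_exp_sum_le (n : nat) (y M : R) (hy : Rabs y <= M) :
  Rabs (exp y - exp_sum n y) <= exp M - exp_sum n M.
Proof.
  assert (H : forall j, Rabs (exp_sum (j + n) y - exp_sum n y) <= exp_sum (j + n) M - exp_sum n M).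
  { induction j as [|j IH].
    - simpl. unfold Rminus. rewrite !Rplus_opp_r, Rabs_R0. lra.
    - change (S j + n)%nat with (S (j + n)). rewrite !exp_sum_S.
      set (m := S (j + n)) in *.
      replace (exp_sum (j + n) y + / INR (fact m) * y ^ m - exp_sum n y)
        with ((exp_sum (j + n) y - exp_sum n y) + / INR (fact m) * y ^ m) by ring.
      apply Rle_trans with (1 := Rabs_triang _ _).
      assert (hf := Rinv_0_lt_compat _ (INR_fact_lt_0 m)).
      rewrite Rabs_mult, (Rabs_pos_eq (/ _)), <- RPow_abs by lra.
      assert (h : Rabs y ^ m <= M ^ m) by (apply pow_incr; split; [apply Rabs_pos|easy]).
      nra. }
  assert (hl : forall z, is_lim_seq (fun j => exp_sum (j + n) z - exp_sum n z) (exp z - exp_sum n z)).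
  { intros z. apply is_lim_seq_minus'; [|apply is_lim_seq_const].
    apply (proj1 (is_lim_seq_incr_n _ n _)), is_lim_seq_exp_sum. }
  apply (is_lim_seq_le _ _ (Rabs (exp y - exp_sum n y)) (exp M - exp_sum n M) H).
  - apply (is_lim_seq_abs _ (exp y - exp_sum n y)), hl.
  - apply hl.
Qed.

Definition cos_moment (n : nat) : R := RInt (fun p => cos p ^ n) 0 PI.

Lemma is_RInt_cos_moment (n : nat) : is_RInt (fun p => cos p ^ n) 0 PI (cos_moment n).
Proof.
  apply (RInt_correct (V := R_CompleteNormedModule)), (ex_RInt_continuous (V := R_CompleteNormedModule)).
  intros p _. apply (ex_derive_continuous (V := R_NormedModule)). auto_derive; easy.
Qed.

Lemma cos_moment_0 : cos_moment 0 = PI.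
Proof.
  unfold cos_moment. simpl. rewrite RInt_const. unfold scal; simpl; unfold mult; simpl. ring.
Qed.

Lemma cos_moment_1 : cos_moment 1 = 0.
Proof.
  apply (is_RInt_unique (V := R_CompleteNormedModule)).
  replace 0 with (minus (sin PI) (sin 0)) at 2.
  - apply (is_RInt_derive (V := R_CompleteNormedModule) sin).
    + intros p _. auto_derive; [easy|]. simpl; ring.
    + intros p _. apply (ex_derive_continuous (V := R_NormedModule)). auto_derive; easy.
  - rewrite sin_PI, sin_0. exact (minus_eq_zero (G := R_AbelianGroup) 0).
Qed.

(** Integrate the derivative of [sin p * (cos p)^(n + 1)]; [sin] vanishes at both [0] and [PI]. *)
Lemma cos_moment_SS (n : nat) :
  cos_moment (S (S n)) = INR (S n) / INR (S (S n)) * cos_moment n.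
Proof.
  assert (h : is_RInt (fun p => INR (S (S n)) * cos p ^ S (S n) - INR (S n) * cos p ^ n) 0 PI
     (minus (sin PI * cos PI ^ S n) (sin 0 * cos 0 ^ S n))).
  { apply (is_RInt_derive (V := R_CompleteNormedModule) (fun p => sin p * cos p ^ S n)).
    - intros p _. auto_derive; [easy|].
      change (match n with O => 1 | S _ => INR n + 1 end) with (INR (S n)).
      assert (e : sin p * sin p = 1 - cos p * cos p)
        by (generalize (sin2_cos2 p); unfold Rsqr; lra).
      rewrite (S_INR (S n)), <- !tech_pow_Rmult. simpl Nat.pred. ring [e].
    - intros p _. apply (ex_derive_continuous (V := R_NormedModule)). auto_derive; easy. }
  assert (h1 := is_RInt_scal (V := R_NormedModule) _ _ _ (INR (S (S n))) _ (is_RInt_cos_moment (S (S n)))).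
  assert (h2 := is_RInt_scal (V := R_NormedModule) _ _ _ (INR (S n)) _ (is_RInt_cos_moment n)).
  assert (h3 := is_RInt_minus (V := R_NormedModule) _ _ _ _ _ _ h1 h2).
  apply (is_RInt_unique (V := R_CompleteNormedModule)) in h.
  apply (is_RInt_unique (V := R_CompleteNormedModule)) in h3.
  assert (e : scal (INR (S (S n))) (cos_moment (S (S n))) - scal (INR (S n)) (cos_moment n) = 0).
  { transitivity (minus (sin PI * cos PI ^ S n) (sin 0 * cos 0 ^ S n)).
    - rewrite <- h. symmetry. exact h3.
    - rewrite sin_PI, sin_0, !Rmult_0_l. exact (minus_eq_zero (G := R_AbelianGroup) 0). }
  change (INR (S (S n)) * cos_moment (S (S n)) - INR (S n) * cos_moment n = 0) in e.
  assert (0 < INR (S (S n))) by (apply lt_0_INR; lia).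
  apply Rmult_eq_reg_l with (INR (S (S n))); [|lra].
  replace (INR (S (S n)) * (INR (S n) / INR (S (S n)) * cos_moment n))
    with (INR (S n) * cos_moment n) by (field; lra).
  lra.
Qed.

Lemma cos_moment_odd (k : nat) : cos_moment (2 * k + 1) = 0.
Proof.
  induction k as [|k IH]; [apply cos_moment_1|].
  replace (2 * S k + 1)%nat with (S (S (2 * k + 1))) by lia.
  rewrite cos_moment_SS, IH. ring.
Qed.

Lemma cos_moment_even (k : nat) :
  cos_moment (2 * k) = PI * INR (fact (2 * k)) / (4 ^ k * (INR (fact k) * INR (fact k))).
Proof.
  induction k as [|k IH].
  - simpl. rewrite cos_moment_0. field.
  - replace (2 * S k)%nat with (S (S (2 * k))) by lia.
    rewrite cos_moment_SS, IH, !fact_simpl, !mult_INR, !S_INR, <- tech_pow_Rmult, mult_INR.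
    assert (hf := INR_fact_lt_0 k). assert (hk := pos_INR k).
    assert (h4 : 4 ^ k <> 0) by (apply pow_nonzero; lra).
    simpl (INR 2). field. lra.
Qed.

Definition bessel_I0_term (x : R) (k : nat) : R := (x / 2) ^ (2 * k) / (INR (fact k) * INR (fact k)).
Definition bessel_I1_term (x : R) (k : nat) : R :=
  (x / 2) ^ (2 * k + 1) / (INR (fact k) * INR (fact (k + 1))).

Lemma is_RInt_exp_term (x : R) (k : nat) :
  is_RInt (fun p => / INR (fact k) * (x * cos p) ^ k * (1 + cos p)) 0 PI
    (x ^ k / INR (fact k) * (cos_moment k + cos_moment (S k))).
Proof.
  assert (h := is_RInt_plus (V := R_NormedModule) _ _ _ _ _ _ (is_RInt_cos_moment k) (is_RInt_cos_moment (S k))).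
  apply (is_RInt_scal (V := R_NormedModule) _ _ _ (x ^ k / INR (fact k))) in h.
  revert h. apply is_RInt_ext. intros p _.
  unfold scal, plus; cbn -[INR]; unfold mult; cbn -[INR].
  rewrite Rpow_mult_distr. field. apply INR_fact_neq_0.
Qed.

(** Odd moments vanish, so in the factor [1 + cos p] the summand [1] pairs with even powers and
    yields [I_0], while [cos p] pairs with odd powers and yields [I_1]. *)
Lemma exp_term_even (x : R) (k : nat) :
  x ^ (2 * k) / INR (fact (2 * k)) * (cos_moment (2 * k) + cos_moment (S (2 * k)))
    = PI * bessel_I0_term x k.
Proof.
  replace (S (2 * k)) with (2 * k + 1)%nat by lia. rewrite cos_moment_odd, cos_moment_even.
  unfold bessel_I0_term. rewrite !pow_mult.
  replace ((x / 2) ^ 2) with (x ^ 2 * / 4) by field. rewrite Rpow_mult_distr, pow_inv.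
  field. repeat split; try apply INR_fact_neq_0. apply pow_nonzero; lra.
Qed.

Lemma exp_term_odd (x : R) (k : nat) :
  x ^ (2 * k + 1) / INR (fact (2 * k + 1)) * (cos_moment (2 * k + 1) + cos_moment (S (2 * k + 1)))
    = PI * bessel_I1_term x k.
Proof.
  rewrite cos_moment_odd. replace (S (2 * k + 1)) with (2 * S k)%nat by lia.
  rewrite cos_moment_even. unfold bessel_I1_term.
  replace (2 * S k)%nat with (S (2 * k + 1)) by lia.
  replace (k + 1)%nat with (S k) by lia.
  rewrite (fact_simpl (2 * k + 1)), (fact_simpl k), !mult_INR, <- (tech_pow_Rmult 4).
  rewrite !pow_add, !pow_mult, !pow_1.
  replace ((x / 2) ^ 2) with (x ^ 2 * / 4) by field. rewrite Rpow_mult_distr, pow_inv.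
  replace (INR (S (2 * k + 1))) with (2 * INR (S k)) by (rewrite !S_INR, plus_INR, mult_INR; simpl; ring).
  assert (0 < INR (S k)) by (apply lt_0_INR; lia).
  field. repeat split; try apply INR_fact_neq_0; try lra. apply pow_nonzero; lra.
Qed.

(** Truncation at the odd degree [2 n + 1] makes even and odd terms come in pairs, so both Bessel
    series are cut at the same index [n]. *)
Lemma is_RInt_exp_sum (x : R) (n : nat) :
  is_RInt (fun p => exp_sum (2 * n + 1) (x * cos p) * (1 + cos p)) 0 PI
    (PI * sum_n (fun k => bessel_I0_term x k + bessel_I1_term x k) n).
Proof.
  induction n as [|n IH].
  - assert (h := is_RInt_plus (V := R_NormedModule) _ _ _ _ _ _
      (is_RInt_exp_term x (2 * 0)) (is_RInt_exp_term x (2 * 0 + 1))).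
    rewrite exp_term_even, exp_term_odd in h.
    rewrite sum_O, Rmult_plus_distr_l.
    revert h. apply is_RInt_ext. intros p _.
    change (2 * 0 + 1)%nat with 1%nat. rewrite exp_sum_S. unfold exp_sum. rewrite sum_O.
    unfold plus; simpl. ring.
  - assert (h := is_RInt_plus (V := R_NormedModule) _ _ _ _ _ _
      (is_RInt_exp_term x (2 * S n)) (is_RInt_exp_term x (2 * S n + 1))).
    rewrite exp_term_even, exp_term_odd in h.
    assert (h2 := is_RInt_plus (V := R_NormedModule) _ _ _ _ _ _ IH h).
    rewrite sum_Sn. unfold plus at 1; simpl plus. rewrite !Rmult_plus_distr_l.
    revert h2. apply is_RInt_ext. intros p _.
    replace (2 * S n + 1)%nat with (S (S (2 * n + 1))) by lia. rewrite !exp_sum_S.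
    replace (2 * S n)%nat with (S (2 * n + 1)) by lia.
    unfold plus; cbn -[INR pow fact Nat.mul Nat.add]. ring.
Qed.

Lemma ex_series_bessel_I0 (x : R) : ex_series (bessel_I0_term x).
Proof.
  apply (ex_series_le (V := R_CompleteNormedModule) _ (fun k => / INR (fact k) * ((x / 2) ^ 2) ^ k)).
  - intros k. unfold bessel_I0_term, norm; simpl; unfold abs; simpl.
    assert (hf := INR_fact_lt_0 k).
    assert (h1 : 1 <= INR (fact k)) by (apply (le_INR 1), lt_O_fact).
    assert (hx : 0 <= ((x / 2) ^ 2) ^ k) by (apply pow_le, pow2_ge_0).
    change (Rabs ((x / 2) ^ (2 * k) / (INR (fact k) * INR (fact k))) <= / INR (fact k) * ((x / 2) ^ 2) ^ k).
    rewrite pow_mult.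
    rewrite Rabs_pos_eq.
    + unfold Rdiv. rewrite Rmult_comm. apply Rmult_le_compat_r; [easy|].
      apply Rinv_le_contravar; nra.
    + apply Rmult_le_pos; [easy|]. apply Rlt_le, Rinv_0_lt_compat. nra.
  - exists (exp ((x / 2) ^ 2)). apply is_lim_seq_exp_sum.
Qed.

Lemma ex_series_bessel_I1 (x : R) : ex_series (bessel_I1_term x).
Proof.
  apply (ex_series_le (V := R_CompleteNormedModule) _ (fun k => Rabs (x / 2) * bessel_I0_term x k)).
  - intros k. unfold bessel_I0_term, bessel_I1_term.
    change (Rabs ((x / 2) ^ (2 * k + 1) / (INR (fact k) * INR (fact (k + 1))))
      <= Rabs (x / 2) * ((x / 2) ^ (2 * k) / (INR (fact k) * INR (fact k)))).
    assert (hf := INR_fact_lt_0 k). assert (hf2 := INR_fact_lt_0 (k + 1)).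
    assert (h1 : INR (fact k) <= INR (fact (k + 1))) by (apply le_INR, fact_le; lia).
    rewrite pow_add, pow_1, pow_mult.
    assert (hx : 0 <= ((x / 2) ^ 2) ^ k) by (apply pow_le, pow2_ge_0).
    unfold Rdiv at 1. rewrite !Rabs_mult, (Rabs_pos_eq (_ ^ k)) by easy.
    rewrite (Rabs_pos_eq (/ _)) by (apply Rlt_le, Rinv_0_lt_compat; nra).
    rewrite (Rmult_comm _ (Rabs _)), Rmult_assoc.
    apply Rmult_le_compat_l; [apply Rabs_pos|]. apply Rmult_le_compat_l; [easy|].
    apply Rinv_le_contravar; nra.
  - apply (ex_series_scal_l (V := R_NormedModule) (Rabs (x / 2)) (bessel_I0_term x)), ex_series_bessel_I0.
Qed.

Lemma is_RInt_exp_cos (x : R) :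
  is_RInt (fun p => exp (x * cos p) * (1 + cos p)) 0 PI (PI * (bessel_I0 x + bessel_I1 x)).
Proof.
  assert (hl : filterlim (fun n p => exp_sum (2 * n + 1) (x * cos p) * (1 + cos p)) eventually
    (locally (T := fct_UniformSpace R R_CompleteNormedModule) (fun p => exp (x * cos p) * (1 + cos p)))).
  { apply filterlim_locally. intros [e he].
    assert (h := is_lim_seq_exp_sum (Rabs x)).
    (* Half of [e] suffices because the weight [1 + cos p] lies between [0] and [2]. *)
    apply is_lim_seq_spec in h. destruct (h (mkposreal (e / 2) ltac:(lra))) as [N hN].
    exists N. intros n hn p. specialize (hN (2 * n + 1)%nat ltac:(lia)). cbn [pos] in hN.
    change (Rabs (exp_sum (2 * n + 1) (x * cos p) * (1 + cos p) - exp (x * cos p) * (1 + cos p)) < e).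
    rewrite <- Rmult_minus_distr_r, Rabs_mult, Rabs_minus_sym.
    assert (hc := COS_bound p).
    rewrite (Rabs_pos_eq (1 + cos p)) by lra.
    assert (h2 := abs_exp_sub_exp_sum_le (2 * n + 1) (x * cos p) (Rabs x)).
    assert (hy : Rabs (x * cos p) <= Rabs x).
    { rewrite Rabs_mult. apply Rle_trans with (Rabs x * 1); [|lra].
      apply Rmult_le_compat_l; [apply Rabs_pos|]. apply Rabs_le; lra. }
    specialize (h2 hy). rewrite Rabs_minus_sym in hN. apply Rabs_def2, proj1 in hN.
    apply Rle_lt_trans with (Rabs (exp (x * cos p) - exp_sum (2 * n + 1) (x * cos p)) * 2).
    - apply Rmult_le_compat_l; [apply Rabs_pos|lra].
    - lra. }
  destruct (filterlim_RInt (V := R_CompleteNormedModule) _ 0 PI eventually _ _ _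
     (is_RInt_exp_sum x) hl) as [I [h1 h2]].
  replace (PI * (bessel_I0 x + bessel_I1 x)) with I; [exact h2|].
  apply (filterlim_locally_unique (F := eventually)
    (fun n => PI * sum_n (fun k => bessel_I0_term x k + bessel_I1_term x k) n)); [exact h1|].
  apply (is_lim_seq_scal_l _ PI (bessel_I0 x + bessel_I1 x)).
  apply (is_series_plus (V := R_NormedModule) (bessel_I0_term x) (bessel_I1_term x));
    apply Series_correct; [apply ex_series_bessel_I0 | apply ex_series_bessel_I1].
Qed.

(** * From the Wallis integral to [Phi] *)

Lemma is_RInt_wallis_subst (r : R) (hr : 0 < r) :
  is_RInt (fun p => (1 + cos p) / 2 * pos_power (cos ((p + sin p) / 2)) (2 * r)) 0 PI (wallis r).
Proof.
  assert (h := is_RInt_comp (V := R_CompleteNormedModule) (fun t => pos_power (cos t) (2 * r))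
    (fun p => (p + sin p) / 2) (fun p => (1 + cos p) / 2) 0 PI).
  cbv beta in h.
  replace ((0 + sin 0) / 2) with 0 in h by (rewrite sin_0; field).
  replace ((PI + sin PI) / 2) with (PI / 2) in h by (rewrite sin_PI; field).
  apply h.
  - intros p _. apply continuous_pos_power_cos; lra.
  - intros p _. split.
    + auto_derive; [easy|field].
    + apply (ex_derive_continuous (V := R_NormedModule)). auto_derive; easy.
Qed.

Lemma wallis_le_Phi (r : R) (hr : 0 < r) : wallis r <= PI / 2 * Phi (2 * r).
Proof.
  assert (hp := PI_RGT_0).
  assert (h := is_RInt_scal (V := R_NormedModule) _ _ _ (exp (- (2 * r)) / 2) _ (is_RInt_exp_cos (2 * r))).
  replace (PI / 2 * Phi (2 * r))
    with (scal (exp (- (2 * r)) / 2) (PI * (bessel_I0 (2 * r) + bessel_I1 (2 * r)))).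
  2:{ unfold Phi, scal; simpl; unfold mult; simpl. field. }
  (* The integrands need comparison only in the open interval, so [p < PI] holds as the cosine bound
     requires; that bound is then raised to the power [2 * r]. *)
  apply (is_RInt_le _ _ 0 PI _ _ ltac:(lra) (is_RInt_wallis_subst r hr) h).
  intros p hpp. destruct (cos_half_add_sin_le p ltac:(lra)) as [h1 h2].
  assert (hc := COS_bound p).
  unfold scal; simpl; unfold mult; simpl.
  replace (exp (- (2 * r)) / 2 * (exp (2 * r * cos p) * (1 + cos p)))
    with ((1 + cos p) / 2 * Rpower (exp (- (1 - cos p))) (2 * r)).
  - apply Rmult_le_compat_l; [lra|]. rewrite pos_power_pos by easy. apply Rle_Rpower_l; lra.
  - unfold Rpower. rewrite ln_exp.
    replace (2 * r * - (1 - cos p)) with (- (2 * r) + 2 * r * cos p) by ring.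
    rewrite exp_plus. field.
Qed.

Lemma Phi_0 : Phi 0 = 1.
Proof.
  assert (h := is_RInt_exp_cos 0).
  apply (is_RInt_unique (V := R_CompleteNormedModule)) in h.
  assert (h2 := is_RInt_plus (V := R_NormedModule) _ _ _ _ _ _ (is_RInt_cos_moment 0) (is_RInt_cos_moment 1)).
  rewrite cos_moment_0, cos_moment_1 in h2.
  apply (is_RInt_ext (V := R_NormedModule) _ (fun p => exp (0 * cos p) * (1 + cos p))) in h2.
  - apply (is_RInt_unique (V := R_CompleteNormedModule)) in h2. rewrite h in h2.
    unfold plus in h2; simpl in h2. unfold Phi. rewrite Ropp_0, exp_0.
    assert (hp := PI_RGT_0). apply Rmult_eq_reg_l with PI; lra.
  - intros p _. rewrite Rmult_0_l, exp_0. unfold plus; simpl. ring.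
Qed.

Theorem theorem3 (r : R) (hr : 0 <= r) :
  Phi (2 * r) = exp (- (2 * r)) * (bessel_I0 (2 * r) + bessel_I1 (2 * r)) /\
  exp (- (2 * r)) * (bessel_I0 (2 * r) + bessel_I1 (2 * r))
    >= Gamma (2 * r + 1) / (Gamma (r + 1) ^ 2) * Rpower 2 (- (2 * r)).
Proof.
  split; [easy|].
  change (Phi (2 * r) >= gamma_quotient r).
  destruct hr as [hr | <-].
  - assert (h1 := gamma_quotient_le_wallis r hr). assert (h2 := wallis_le_Phi r hr).
    assert (hp := PI_RGT_0).
    apply Rle_ge, Rmult_le_reg_l with (PI / 2); lra.
  (* At [r = 0] both sides equal [1]. *)
  - rewrite Rmult_0_r, Phi_0, gamma_quotient_0. lra.
Qed.
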